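(* Let $r$ and $s$ be two distinct prime numbers, and let $$E^r=\left\{\sum_{j=1}^\infty\eta_j(rs)^{-j} : \eta_j\in\{0,1,\ldots,r-1\}\right\},\qquad E^s=\left\{\sum_{j=1}^\infty\eta_j'(rs)^{-j} : \eta_j'\in\{0,1,\ldots,s-1\}\right\},$$ regarded as subsets of $\mathbb{R}\subset\mathbb{C}$ (the superscripts are labels). Then the union of all line segments joining a point of $E^r$ to a point of $rE^s+i$ is a Besicovitch set in the following (wide) sense: it has two-dimensional Lebesgue measure zero, and it contains line segments in all directions belonging to some nonempty open set of directions.
   Context: The plane $\mathbb{R}^2$ is identified with $\mathbb{C}$, and $i$ is the imaginary unit. A Besicovitch set in the wide sense in $\mathbb{R}^n$ is a set of $n$-dimensional Lebesgue measure zero which contains (nondegenerate) line segments in all directions belonging to a nonempty open set of directions. *)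

(* Defs.v *)
From mathcomp Require Import all_boot all_order all_algebra.
From mathcomp Require Import all_classical all_reals all_analysis.
Set Implicit Arguments.
Unset Strict Implicit.
Unset Printing Implicit Defensive.
Import Order.TTheory GRing.Theory Num.Theory.
Import numFieldNormedType.Exports.
Local Open Scope classical_set_scope.
Local Open Scope ring_scope.

(* The plane R^2 = C is R * R: the real x is (x, 0), and i is (0, 1). *)
Definition real_pt (R : realType) (x : R) : R * R := (x, 0).
Definition imag_unit (R : realType) : R * R := (0, 1).
Arguments imag_unit R : clear implicits.

Definition segment (R : realType) (p q : R * R) : set (R * R) :=
  [set (1 - t) *: p + t *: q | t in `[0, 1]%classic].

Definition segments_between (R : realType) (A B : set (R * R)) :
    set (R * R) :=
  \bigcup_(p in A) \bigcup_(q in B) segment p q.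

(* Directions are the points of the Euclidean unit circle; the norm of the
   library on R * R is the sup norm, so the circle is written out. *)
Definition unit_circle (R : realType) : set (R * R) :=
  [set u | u.1 ^+ 2 + u.2 ^+ 2 = 1].
Arguments unit_circle R : clear implicits.

Definition contains_segment_in_direction (R : realType) (K : set (R * R))
    (u : R * R) : Prop :=
  exists (p : R * R) (l : R), 0 < l /\ segment p (p + l *: u) `<=` K.

(* The product measure is a measure on Borel sets; being negligible, i.e.
   included in a Borel set of measure 0, is being Lebesgue-null. *)
Definition plane_null (R : realType) (K : set (R * R)) : Prop :=
  (@lebesgue_measure R \x @lebesgue_measure R)%E.-negligible K.

(* The open sets of directions are the traces on the circle of the open sets V
   of the plane. *)
Definition wide_besicovitch (R : realType) (K : set (R * R)) : Prop :=
  plane_null K /\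
  exists V : set (R * R),
    [/\ open V, V `&` unit_circle R !=set0 &
        forall u, (V `&` unit_circle R) u -> contains_segment_in_direction K u].

(* The sums of the series eta_1 b^-1 + eta_2 b^-2 + ... with digits eta_j in
   {0, ..., d - 1}; the value eta 0 is not used. *)
Definition digit_set (R : realType) (b d : nat) : set R :=
  [set x | exists eta : nat -> 'I_d,
     (\sum_(1 <= j < n.+1) (eta j)%:R * b%:R ^- j : R) @[n --> \oo] --> x].
Arguments digit_set R b d : clear implicits.

(* Main.v *)
Require Import Defs.
From mathcomp Require Import all_boot all_order all_algebra.
From mathcomp Require Import all_classical all_reals all_analysis.
From mathcomp Require Import measurable_realfun ring lra.
Set Implicit Arguments.
Unset Strict Implicit.
Unset Printing Implicit Defensive.
Import Order.TTheory GRing.Theory Num.Theory.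
Import numFieldNormedType.Exports.
Local Open Scope classical_set_scope.
Local Open Scope ring_scope.

(** Put N = r s.  The slice of the union at height t is (1 - t) E^r + t r E^s,
    the self-similar set with ratio 1/N and the N digits (1 - t) u + t r v for
    0 <= u < r and 0 <= v < s; it is approximated by the countable set P of the
    values of finite words.
    - If two distinct words of the same length k have values at distance
      o(N^-k), then two of the N^k pieces of P almost coincide, and P has
      arbitrarily small neighbourhoods of arbitrarily small measure.
    - For every t, two pieces of P with different first digits are arbitrarily
      close: otherwise the neighbourhoods of P of radii rho and N rho would have
      the same measure.  Hence for all k there are two words of length k with
      different first digits, and values at distance O(N^-k); the difference of
      these values is an affine function of t whose slope is bounded below, so
      it vanishes at distance O(N^-k) from t.
    - Hence the set of the t at which all differences of values of distinct
      words of length k are at least e N^-k is porous, and so it is null by the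
      Lebesgue density theorem.  Fubini's theorem concludes.

    For the directions, E^r + r E^s = [0, 1] and E^r = c - E^r where
    c = (r - 1) / (N - 1), so r E^s - E^r = [-c, 1 - c]. *)

(** * Values of finite words and their neighbourhoods *)

Section words.
Variables (R : realType) (D : finType) (N : nat).
Hypothesis N_gt1 : (1 < N)%N.
Implicit Types (f g : D -> R) (u v w : seq D).

(** Horner form of the sum of the [f w_j * N ^- j], most significant digit first: prepending [d]
    applies the contraction [x |-> (f d + x) / N]. *)
Fixpoint word_val f w : R :=
  if w is d :: w' then (f d + word_val f w') / N%:R else 0.

Let N_gt0 : 0 < N%:R :> R.
Proof. by rewrite ltr0n ltnW. Qed.

Let N_neq0 : N%:R != 0 :> R.
Proof. by rewrite gt_eqF. Qed.

Let N_ge2 : 2 <= N%:R :> R.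
Proof. by rewrite ler_nat. Qed.

Lemma word_val_cat f u v :
  word_val f (u ++ v) = word_val f u + word_val f v / N%:R ^+ size u.
Proof.
elim: u => [|d u IHu] /=; first by rewrite expr0 divr1 add0r.
by rewrite IHu exprS; field; rewrite expf_neq0 // N_neq0.
Qed.

Lemma word_val_nseq0 f d n : f d = 0 -> word_val f (nseq n d) = 0.
Proof. by move=> fd0; elim: n => //= n ->; rewrite fd0 addr0 mul0r. Qed.

Lemma word_val_linear f g a b w :
  word_val (fun d => a * f d + b * g d) w = a * word_val f w + b * word_val g w.
Proof. by elim: w => /= [|d w ->]; [ring|field; exact: N_neq0]. Qed.

Lemma word_val_norm f c w : (forall d, `|f d| <= c) -> 0 <= c ->
  `|word_val f w| <= c.
Proof.
move=> fc c0; elim: w => /= [|d w IHw]; first by rewrite normr0.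
rewrite normrM normfV (gtr0_norm N_gt0) ler_pdivrMr//.
apply: le_trans (ler_normD _ _) _; move: (fc d) IHw N_ge2 c0.
set a := `|_|; set b := `|_|; nra.
Qed.

(** The contractions preserve [[0, c]], since [(c * (N - 1) + c) / N = c]. *)
Lemma word_val_itv f (c : R) w : (forall d, 0 <= f d <= c * (N%:R - 1)) ->
  0 <= c -> 0 <= word_val f w <= c.
Proof.
move=> fc c0; elim: w => /= [|d w /andP[w0 wc]]; first by rewrite lexx.
have /andP[d0 dc] := fc d.
rewrite divr_ge0 ?addr_ge0//= ?(ltW N_gt0)// ler_pdivrMr//; lra.
Qed.

(** Forces the length to be [k]; the padding letter [z] will have digit 0, so that padding leaves
    the value unchanged. *)
Definition pad_take z k w := take k (w ++ nseq k z).

Lemma size_pad_take z k w : size (pad_take z k w) == k.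
Proof. by rewrite size_takel // size_cat size_nseq leq_addl. Qed.

Lemma word_val_pad_take f z k w : f z = 0 ->
  exists v, word_val f w = word_val f (pad_take z k w) + word_val f v / N%:R ^+ k.
Proof.
move=> fz; exists (drop k (w ++ nseq k z)).
have {1}-> : word_val f w = word_val f (pad_take z k w ++ drop k (w ++ nseq k z)).
  by rewrite cat_take_drop word_val_cat word_val_nseq0// mul0r addr0.
by rewrite word_val_cat (eqP (size_pad_take z k w)).
Qed.

Lemma word_val_map_iota f (eta : nat -> D) n :
  word_val f [seq eta j | j <- iota 1 n] =
  \sum_(1 <= j < n.+1) f (eta j) * N%:R ^- j.
Proof.
elim: n => [|n IHn]; first by rewrite big_geq.
have -> : iota 1 n.+1 = iota 1 n ++ [:: n.+1] by rewrite -[in LHS](addn1 n) iotaD add1n.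
rewrite big_nat_recr// -IHn map_cat word_val_cat size_map size_iota /= addr0 exprS.
by congr (_ + _); field; rewrite expf_neq0 // N_neq0.
Qed.

(** Open neighbourhoods of the countable set P stand in for the self-similar set, so that
    measurability is immediate. *)
Definition word_nbhd f (rho : R) : set R :=
  [set x | exists w, `|x - word_val f w| < rho].

Lemma word_nbhdE f rho :
  word_nbhd f rho = \bigcup_w ball (word_val f w) rho.
Proof.
apply/seteqP; split=> x; first by move=> [w wx]; exists w => //; rewrite /ball/= distrC.
by move=> [w _]; rewrite /ball/= distrC; exists w.
Qed.

Lemma open_word_nbhd f rho : open (word_nbhd f rho).
Proof. by rewrite word_nbhdE; apply: bigcup_open => w _; exact: ball_open. Qed.

Lemma measurable_word_nbhd f rho : measurable (word_nbhd f rho).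
Proof. apply: open_measurable; exact: open_word_nbhd. Qed.

Lemma word_nbhdS f rho rho' : rho <= rho' -> word_nbhd f rho `<=` word_nbhd f rho'.
Proof. by move=> le x [w wx]; exists w; apply: lt_le_trans le. Qed.

Lemma word_nbhd_shift f rho e x y : word_nbhd f rho x -> `|y - x| <= e ->
  word_nbhd f (rho + e) y.
Proof.
move=> [w wx] yx; exists w.
have -> : y - word_val f w = (x - word_val f w) + (y - x) by ring.
by apply: le_lt_trans (ler_normD _ _) _; lra.
Qed.

(** Inverse of the contraction attached to [w], when [k] is the length of [w]. *)
Definition zoom f k w (x : R) := N%:R ^+ k * (x - word_val f w).

(** P is the union of its pieces of level [k], which are copies of ratio [N ^- k]; zooming in
    multiplies the radius by [N ^ k]. *)
Lemma word_nbhd_zoom f z rho k x : f z = 0 -> word_nbhd f rho x ->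
  exists w : k.-tuple D, word_nbhd f (N%:R ^+ k * rho) (zoom f k w x).
Proof.
move=> fz [w wx].
have [v vE] := word_val_pad_take k w fz.
exists (Tuple (size_pad_take z k w)), v.
rewrite /zoom/=.
have Nk : 0 < N%:R ^+ k :> R by rewrite exprn_gt0.
have -> : N%:R ^+ k * (x - word_val f (pad_take z k w)) - word_val f v =
   N%:R ^+ k * (x - word_val f w).
  by rewrite vE; field; rewrite gt_eqF.
by rewrite normrM (gtr0_norm Nk) ltr_pM2l.
Qed.

End words.

(** * Lebesgue measure under affine maps *)

Section affine_measure.
Variable R : realType.
Notation mu := (@lebesgue_measure R).

(** By uniqueness of Lebesgue measure: [a] times the pushforward agrees with it on half-open
    intervals. *)
Lemma lebesgue_measure_affine (a b : R) (A : set R) : 0 < a -> measurable A ->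
  mu ((fun x => a * (x - b)) @^-1` A) = (a^-1%:E * mu A)%E.
Proof.
move=> a0 mA.
pose phi (x : measurableTypeR R) : measurableTypeR R := a * (x - b).
have mphi : measurable_fun setT phi.
  by apply: measurable_funM => //; apply: measurable_funB.
have -> : mu A = mscale (NngNum (ltW a0)) (pushforward mu phi) A.
  rewrite (@lebesgue_measure_unique _ (mscale (NngNum (ltW a0)) (pushforward mu phi)))//.
  move=> _ [[x y] _ <-].
  change (mu `]x, y]%classic = a%:E * mu (phi @^-1` `]x, y]%classic))%E.
  rewrite [X in (_ * mu X)%E](_ : _ = `](x / a + b), (y / a + b)]%classic); last first.
    apply/funext => z; apply/propext; rewrite /phi /= !in_itv/=.
    have -> : (x / a + b < z) = (x < a * (z - b)).
      by rewrite -ltrBrDr ltr_pdivrMr// mulrC.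
    by have -> : (z <= y / a + b) = (a * (z - b) <= y)
      by rewrite -lerBlDr ler_pdivlMr// mulrC.
  rewrite !lebesgue_measure_itv/= !lte_fin ltrD2r ltr_pM2r ?invr_gt0//.
  case: ifPn => xy; last by rewrite mule0.
  by rewrite -!EFinB -EFinM; congr EFin; field; rewrite gt_eqF.
change (mu (phi @^-1` A) = a^-1%:E * (a%:E * mu (phi @^-1` A)))%E.
by rewrite muleA -EFinM mulVf ?gt_eqF// mul1e.
Qed.

End affine_measure.

Lemma fsbig_finType (T : Type) (idx : T) (op : Monoid.com_law idx)
    (I : finType) (F : I -> T) :
  \big[op/idx]_(i \in [set: I]) F i = \big[op/idx]_(i : I) F i.
Proof.
rewrite -big_enum (fsbig_seq _ _ (enum_uniq I)); congr (\big[op/idx]_(i \in _) _).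
by apply/seteqP; split=> i //= _; rewrite mem_enum.
Qed.

(** * Measure of the neighbourhoods of a self-similar set with N pieces of ratio 1/N *)

Section self_similar_measure.
Variables (R : realType) (D : finType) (N : nat).
Hypotheses (N_gt1 : (1 < N)%N) (cardD : #|D| = N).
Variables (f : D -> R) (z : D).
Hypothesis fz : f z = 0.
Notation mu := (@lebesgue_measure R).
Notation word_val := (@word_val R D N f).
Notation word_nbhd := (@word_nbhd R D N f).
Notation zoom := (@zoom R D N f).

Let N_gt0 : 0 < N%:R :> R.
Proof. by rewrite ltr0n ltnW. Qed.

Let Nk_gt0 k : 0 < N%:R ^+ k :> R.
Proof. by rewrite exprn_gt0. Qed.

Let c := \sum_d `|f d|.

Let c_ge0 : 0 <= c.
Proof. exact: sumr_ge0. Qed.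

Let word_val_le w : `|word_val w| <= c.
Proof.
apply: word_val_norm => // d.
by rewrite /c (bigD1 d)//= lerDl sumr_ge0.
Qed.

Lemma measurable_zoom k w (A : set R) : measurable A ->
  measurable (zoom k w @^-1` A).
Proof.
move=> mA; rewrite -[X in measurable X]setTI.
have mphi : measurable_fun setT
    (zoom k w : measurableTypeR R -> measurableTypeR R).
  by apply: measurable_funM => //; apply: measurable_funB.
exact: mphi.
Qed.

Lemma lebesgue_measure_zoom k w (A : set R) : measurable A ->
  mu (zoom k w @^-1` A) = ((N%:R ^- k)%:E * mu A)%E.
Proof. exact: lebesgue_measure_affine. Qed.

Lemma word_nbhd_fin rho : mu (word_nbhd rho) \is a fin_num.
Proof.
rewrite ge0_fin_numE//; apply: (@le_lt_trans _ _ (mu (ball 0 (c + `|rho|)))).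
  rewrite le_measure// ?inE; [exact: measurable_word_nbhd|exact: measurable_ball|].
  move=> x [w wx]; rewrite /ball/= sub0r normrN.
  have -> : x = (x - word_val w) + word_val w by rewrite subrK.
  have := ler_normD (x - word_val w) (word_val w).
  have := word_val_le w; have := ler_norm rho; move: wx; lra.
by rewrite lebesgue_measure_ball ?ltry// addr_ge0.
Qed.

(** Beyond the supremum [m] of the values, [[m + rho, m + 3 rho / 2[] misses the smaller
    neighbourhood; a value within [rho / 2] of [m] puts it in the larger one, as [N >= 2]. *)
Lemma word_nbhd_lt rho : 0 < rho ->
  (mu (word_nbhd rho) < mu (word_nbhd (N%:R * rho)))%E.
Proof.
move=> rho0; pose P := range word_val.
have supP : has_sup P.
  split; first by exists (word_val [::]), [::].
  by exists c => _ [w _ <-]; apply: le_trans (ler_norm _) (word_val_le w).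
have [p [w _ <-] pw] := sup_adherent (divr_gt0 rho0 (ltr0Sn R 1)) supP.
set m := sup P in pw.
pose I := `](m + rho), (m + rho + rho / 2)[%classic : set R.
have mI : measurable I by exact: measurable_itv.
have muI : mu I = (rho / 2)%:E.
  rewrite /I lebesgue_measure_itv/= lte_fin ltrDl divr_gt0//.
  by rewrite -EFinB; congr EFin; ring.
have dj : word_nbhd rho `&` I = set0.
  rewrite -subset0 => x [[v vx]]; rewrite /I/= in_itv/= => /andP[mx _].
  have vm : word_val v <= m by apply: ub_le_sup; [exact: supP.2|exists v].
  by move: (le_lt_trans (ler_norm _) vx); lra.
have sub : word_nbhd rho `|` I `<=` word_nbhd (N%:R * rho).
  have N2 : 2 <= N%:R :> R by rewrite ler_nat.
  move=> x [xr|]; first by apply: word_nbhdS xr; nra.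
  rewrite /I/= in_itv/= => /andP[mx xm]; exists w.
  have wm : word_val w <= m by apply: ub_le_sup; [exact: supP.2|exists w].
  rewrite ger0_norm; [nra|lra].
have le : (mu (word_nbhd rho) + (rho / 2)%:E <= mu (word_nbhd (N%:R * rho)))%E.
  rewrite -muI -measureU//; last exact: measurable_word_nbhd.
  rewrite le_measure// ?inE; last exact: measurable_word_nbhd.
  by apply: measurableU => //; exact: measurable_word_nbhd.
by apply: lt_le_trans le; rewrite lteDl ?word_nbhd_fin// lte_fin divr_gt0.
Qed.

(* Otherwise the pieces [(f d + P) / N] would have disjoint neighbourhoods, and
   the neighbourhoods of [P] of radii [rho] and [N * rho] would have the same
   measure. *)
Lemma close_first_digits rho : 0 < rho -> exists d d' v v',
  d != d' /\ `|word_val (d :: v) - word_val (d' :: v')| < rho.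
Proof.
move=> rho0; apply: contrapT => far.
pose piece d := zoom 1 [:: d] @^-1` word_nbhd (N%:R * (rho / 2)).
have pieceP d x : piece d x -> exists v, `|x - word_val (d :: v)| < rho / 2.
  move=> [v xv]; exists v; move: xv.
  have -> : zoom 1 [:: d] x - word_val v = N%:R * (x - word_val (d :: v)).
    by rewrite /zoom /= addr0 expr1; field; rewrite gt_eqF.
  by rewrite normrM (gtr0_norm N_gt0) ltr_pM2l.
have mpiece d : measurable (piece d).
  by apply: measurable_zoom; exact: measurable_word_nbhd.
have E : mu (word_nbhd (rho / 2)) = mu (word_nbhd (N%:R * (rho / 2))).
  have -> : word_nbhd (rho / 2) = \bigcup_(d in [set: D]) piece d.
    apply/seteqP; split=> x.
      move=> /(word_nbhd_zoom N_gt1 1 fz)[w]; rewrite expr1.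
      by case/tupleP: w => d w; rewrite (tuple0 w); exists d.
    by move=> [d _] /pieceP[v xv]; exists (d :: v).
  rewrite measure_fin_bigcup//; [|exact: finite_finset| |by move=> d _; exact: mpiece];
    last first.
    apply/trivIsetP => d d' _ _ dd'; rewrite -subset0 => x [/pieceP[v xv] /pieceP[v' xv']].
    apply: far; exists d, d', v, v'; split=> //.
    have -> : word_val (d :: v) - word_val (d' :: v') =
      (x - word_val (d' :: v')) - (x - word_val (d :: v)) by ring.
    by apply: le_lt_trans (ler_normB _ _) _; lra.
  rewrite fsbig_finType
    (eq_bigr (fun=> (N%:R^-1)%:E * mu (word_nbhd (N%:R * (rho / 2)))))%E; last first.
    by move=> d _; exact: (lebesgue_measure_zoom 1 [:: d] (measurable_word_nbhd _ _ _)).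
  rewrite -(fineK (word_nbhd_fin _)) -EFinM sumEFin sumr_const cardD; congr EFin.
  by rewrite -[LHS]mulr_natl mulrA mulfV ?mul1r// gt_eqF.
by have := word_nbhd_lt (divr_gt0 rho0 (ltr0Sn R 1)); rewrite -E ltxx.
Qed.

(* Merging two almost coinciding pieces gives 2 |P_0| <= |P_2e|, where |P_e| is
   the measure of the [e]-neighbourhood of [P] and |P_0| the infimum of these. *)
Lemma word_nbhd_small :
  (forall e, 0 < e -> exists k (w w' : k.-tuple D),
     w != w' /\ N%:R ^+ k * `|word_val w - word_val w'| < e) ->
  forall e, 0 < e -> exists2 rho, 0 < rho & (mu (word_nbhd rho) < e%:E)%E.
Proof.
move=> close e e0.
pose V rho := fine (mu (word_nbhd rho)).
have VE rho : mu (word_nbhd rho) = (V rho)%:E by rewrite fineK// word_nbhd_fin.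
have V_ge0 rho : 0 <= V rho by rewrite fine_ge0.
have VS rho rho' : rho <= rho' -> V rho <= V rho'.
  move=> le; rewrite -lee_fin -!VE le_measure// ?inE;
    [exact: measurable_word_nbhd..|exact: word_nbhdS].
pose S := [set V rho | rho in [set rho | 0 < rho]].
have infS : has_inf S.
  by split; [exists (V 1), 1 => //=|exists 0 => _ [rho _ <-]].
pose V0 := inf S.
have V0_le rho : 0 < rho -> V0 <= V rho.
  by move=> rho0; apply: ge_inf; [exact: infS.2|exists rho].
have adh a : 0 < a -> exists2 rho, 0 < rho & V rho < V0 + a.
  by move=> a0; have [_ [rho rho0 <-] lt] := inf_adherent a0 infS; exists rho.
(* Applied with [d = rho / 2], the claim gives [2 * V0 <= V rho] for all [rho > 0], hence
   [2 * V0 <= V0]. *)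
suff key d : 0 < d -> 2 * V0 <= V (d + d).
  have V00 : V0 <= 0.
    have : 2 * V0 <= V0.
      apply: lb_le_inf; first exact: infS.1.
      move=> _ [rho rho0 <-]; rewrite [rho]splitr; apply: key.
      by rewrite divr_gt0.
    lra.
  have [rho rho0 lt] := adh _ e0; exists rho => //.
  by rewrite VE lte_fin; lra.
move=> d0; have [k [w [w' [ww' ww'd]]]] := close _ d0.
pose K : R := N%:R ^+ k.
have K0 : 0 < K by exact: Nk_gt0.
apply/ler_addgt0Pr => a a0.
have [tau0 tau00 tau0lt] := adh (a / K) (divr_gt0 a0 K0).
pose tau := Num.min tau0 d.
have tau_gt0 : 0 < tau by rewrite lt_min tau00.
have tau_le : tau <= d by rewrite ge_min lexx orbT.
have Vtau : V tau < V0 + a / K.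
  by apply: le_lt_trans tau0lt; apply: VS; rewrite ge_min lexx.
(* The piece of [w'] is dropped: after zooming, the values of [w] and [w'] differ by less than [d],
   so radius [d + d >= tau + d] around the piece of [w] covers both. *)
pose A (v : k.-tuple D) := zoom k v @^-1`
  (if v == w' then set0 else if v == w then word_nbhd (d + d) else word_nbhd tau).
have cover : word_nbhd (tau / K) `<=` \bigcup_(v in [set: k.-tuple D]) A v.
  move=> x /(word_nbhd_zoom N_gt1 k fz)[v]; rewrite -/K mulrC divfK ?gt_eqF// => xv.
  have [vw'|vw'] := eqVneq v w'; last first.
    exists v => //; rewrite /A /= (negbTE vw'); case: ifP => // _.
    by apply: word_nbhdS xv; lra.
  exists w => //; rewrite /A /= (negbTE ww') eqxx.
  rewrite vw' in xv; have le_td : tau + d <= d + d by rewrite lerD2r.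
  apply: (word_nbhdS le_td); apply: word_nbhd_shift xv _.
  have -> : zoom k w x - zoom k w' x = N%:R ^+ k * (word_val w' - word_val w).
    by rewrite /zoom; ring.
  by rewrite normrM (gtr0_norm (Nk_gt0 k)) distrC ltW.
have mset v : measurable (if v == w' then set0 else
    if v == w then word_nbhd (d + d) else word_nbhd tau).
  by case: ifP => // _; case: ifP => _; exact: measurable_word_nbhd.
have muA v : mu (A v) =
    (K^-1 * (if v == w' then 0 else if v == w then V (d + d) else V tau))%:E.
  rewrite /A lebesgue_measure_zoom// EFinM; congr (_ * _)%E.
  by case: ifP => _; [rewrite measure0|case: ifP => _; rewrite VE].
have mA v : measurable (A v).
  exact: measurable_zoom.
have : (mu (word_nbhd (tau / K)) <= \sum_(v \in [set: k.-tuple D]) mu (A v))%E.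
  exact: (@content_sub_fsum _ _ _ mu _ setT _ A finite_finset (fun v _ => mA v)
    (measurable_word_nbhd _ _ _) cover).
rewrite fsbig_finType (eq_bigr _ (fun v _ => muA v)) sumEFin VE lee_fin -mulr_sumr.
rewrite (bigD1 w')//= eqxx add0r (bigD1 w)//= (negbTE ww') eqxx.
rewrite (eq_bigr (fun=> V tau)); last by move=> v /andP[/negbTE -> /negbTE ->].
rewrite sumr_const.
(* With [n = K - 2] words left, [K * V0 <= V (d + d) + n * V tau <= V (d + d) + n * V0 + a]. *)
set n := #|_|; have nE : n.+2 = (N ^ k)%N.
  rewrite -cardD -card_tuple -[RHS](cardC (pred2 w w')) card2 ww'.
  congr (_.+2); apply: eq_card => v.
  by rewrite !inE negb_or andbC.
have KE : K = n%:R + 2 by rewrite /K -natrX -nE -addn2 natrD.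
rewrite [K^-1 * _]mulrC ler_pdivlMr// -[V tau *+ n]mulr_natl.
have := V0_le _ (divr_gt0 tau_gt0 K0).
have n0 : 0 <= n%:R :> R by [].
set x := V (tau / K) => x1 x2.
have : V0 * K <= x * K by rewrite ler_pM2r.
have : n%:R * V tau <= n%:R * (V0 + a / K) by apply: ler_wpM2l => //; exact: ltW.
have : n%:R * (a / K) <= a.
  by rewrite mulrA ler_pdivrMr// mulrC ler_pM2l// KE lerDl.
rewrite mulrDr {2}KE; move: x2; rewrite KE; lra.
Qed.

End self_similar_measure.

(** At almost every point of [A] the density of [A] is 1, whereas holes of relative size [k] keep
    the ratio at most [1 - k] at arbitrarily small scales. *)
Lemma porous_negligible (R : realType) (A : set R) : measurable A ->
  (forall x, A x -> exists2 k : R, 0 < k & forall h0, 0 < h0 -> exists h y,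
     [/\ 0 < h, h < h0, ball y (k * h) `<=` ball x h &
         A `&` ball y (k * h) = set0]) ->
  (@lebesgue_measure R).-negligible A.
Proof.
move=> mA porous; pose mu := @lebesgue_measure R.
apply: negligibleS (lebesgue_density mA) => x Ax /=.
rewrite indicE mem_set//= => cvg1.
have [k k0 holes] := porous x Ax.
have : nbhs (1%:E : \bar R) [set y | ((1 - k)%:E < y)%E].
  by apply: (@nbhs_open_ereal_gt _ 1 (fun=> 1 - k)); rewrite ltrBlDr ltrDl.
move=> /cvg1[/= h0 h00 near0].
have [h [y [h_gt0 hh0 sub dj]]] := holes _ h00.
have := near0 h; rewrite /ball/= sub0r normrN (gtr0_norm h_gt0).
move=> /(_ hh0 h_gt0); rewrite lebesgue_measure_ball ?(ltW h_gt0)//.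
have h2 : 0 < h *+ 2 by rewrite mulrn_wgt0.
rewrite inver gt_eqF//= lte_pdivlMr// => lt.
have kh0 : 0 < k * h by rewrite mulr_gt0.
have : (mu (A `&` ball x h) + mu (ball y (k * h)) <= mu (ball x h))%E.
  rewrite -measureU.
  - rewrite le_measure// ?inE; [|exact: measurable_ball|by move=> w [[]|/sub]].
    apply: measurableU; last exact: measurable_ball.
    by apply: measurableI => //; exact: measurable_ball.
  - by apply: measurableI => //; exact: measurable_ball.
  - exact: measurable_ball.
  - by rewrite setIAC dj set0I.
rewrite /mu !lebesgue_measure_ball ?(ltW h_gt0) ?(ltW kh0)//.
move=> le; move: lt; rewrite -(@lteD2rE _ (k * h *+ 2)%:E)// => /lt_le_trans/(_ le).
rewrite -EFinM -EFinD (_ : _ + _ = h *+ 2) ?ltxx//.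
by ring.
Qed.

(** * Slices as a family of self-similar sets, affine in the height t *)

Section family.
Variables (R : realType) (D : finType) (N : nat).
Hypotheses (N_gt1 : (1 < N)%N) (cardD : #|D| = N).
Variables (u g : D -> R) (z : D).
Hypotheses (uz : u z = 0) (gz : g z = 0).
Notation mu := (@lebesgue_measure R).
Notation word_val := (@word_val R D N).

Definition digit_family (t : R) d := (1 - t) * u d + t * g d.

Variable e0 : R.
Hypothesis e0_gt0 : 0 < e0.
Hypothesis separated : forall d d' v v', d != d' ->
  e0 <= Num.max `|word_val u (d :: v) - word_val u (d' :: v')|
                `|word_val g (d :: v) - word_val g (d' :: v')|.

Let N_gt0 : 0 < N%:R :> R.
Proof. by rewrite ltr0n ltnW. Qed.

Let Nk_gt0 k : 0 < N%:R ^+ k :> R.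
Proof. by rewrite exprn_gt0. Qed.

Let family_z t : digit_family t z = 0.
Proof. by rewrite /digit_family uz gz !mulr0 addr0. Qed.

Lemma word_val_family t w :
  word_val (digit_family t) w = (1 - t) * word_val u w + t * word_val g w.
Proof. exact: word_val_linear. Qed.

(* The slopes of the affine functions t |-> word_val (digit_family t) w are
   the values of [g - u]. *)
Lemma close_words_steep t : 0 <= t <= 1 -> exists2 C : R, 0 < C &
  forall M, exists k (w w' : k.-tuple D), [/\ w != w',
    N%:R ^+ k * `|word_val (digit_family t) w - word_val (digit_family t) w'| <= C &
    M <= N%:R ^+ k * `|(word_val g w - word_val u w) - (word_val g w' - word_val u w')|].
Proof.
move=> /andP[t0 t1]; pose c := \sum_d `|digit_family t d|.
have c0 : 0 <= c by exact: sumr_ge0.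
have val_c w : `|word_val (digit_family t) w| <= c.
  by apply: word_val_norm => // d; rewrite /c (bigD1 d)//= lerDl sumr_ge0.
(* The 1 comes from the two close values, the [2 * c] from cutting off their tails after [k.+1]
   letters. *)
exists (1 + 2 * c) => [|M]; first lra.
set C := 1 + 2 * c.
have [k kM] : exists k : nat, M + C <= N%:R ^+ k.+1 * e0.
  exists (Num.truncn `|(M + C) / e0|); rewrite -ler_pdivrMr//.
  apply: le_trans (ler_norm _) _; apply: le_trans (ltW (truncnS_gt _)) _.
  rewrite -natrX ler_nat; apply: ltnW; exact: ltn_expl.
have Nk0 : 0 < (N%:R ^+ k.+1)^-1 :> R by rewrite invr_gt0.
have [d [d' [v [v' [dd' lt]]]]] := close_first_digits N_gt1 cardD (family_z t) Nk0.
pose W := Tuple (size_pad_take z k.+1 (d :: v)).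
pose W' := Tuple (size_pad_take z k.+1 (d' :: v')).
have sep := separated (take k (v ++ nseq k.+1 z)) (take k (v' ++ nseq k.+1 z)) dd'.
exists k.+1, W, W'.
have close : N%:R ^+ k.+1 *
    `|word_val (digit_family t) W - word_val (digit_family t) W'| <= C.
  have [x xE] := word_val_pad_take N_gt1 k.+1 (d :: v) (family_z t).
  have [x' x'E] := word_val_pad_take N_gt1 k.+1 (d' :: v') (family_z t).
  rewrite -[X in X * _ <= _](gtr0_norm (Nk_gt0 _)) -normrM.
  have -> : N%:R ^+ k.+1 * (word_val (digit_family t) W - word_val (digit_family t) W') =
     N%:R ^+ k.+1 * (word_val (digit_family t) (d :: v) - word_val (digit_family t) (d' :: v'))
     - (word_val (digit_family t) x - word_val (digit_family t) x').
    rewrite -[tval W]/(pad_take z k.+1 (d :: v)) -[tval W']/(pad_take z k.+1 (d' :: v')).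
    move: (Nk_gt0 k.+1) => K0; rewrite xE x'E; set K := _ ^+ _ in K0 *.
    by field; rewrite gt_eqF.
  apply: le_trans (ler_normB _ _) _; apply: lerD; last first.
    by apply: le_trans (ler_normB _ _) _; rewrite mulr_natl mulr2n lerD.
  by rewrite normrM (gtr0_norm (Nk_gt0 _)) mulrC -ler_pdivlMr// div1r ltW.
split=> //.
  apply/eqP => WW'; move: sep.
  rewrite -[d :: _]/(tval W) -[d' :: _]/(tval W') WW' !subrr normr0 maxxx.
  by rewrite leNgt e0_gt0.
move: sep close; rewrite -[d :: _]/(tval W) -[d' :: _]/(tval W') !word_val_family.
set a := word_val u W; set a' := word_val u W'.
set b := word_val g W; set b' := word_val g W'.
set K := N%:R ^+ k.+1 in kM *.
have K0 : 0 < K by exact: Nk_gt0.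
have -> : K * `|(1 - t) * a + t * b - ((1 - t) * a' + t * b')| =
   `|(1 - t) * (K * (a - a')) + t * (K * (b - b'))|.
  by rewrite -[X in X * _](gtr0_norm K0) -normrM; congr (`|_|); ring.
have -> : K * `|(b - a) - (b' - a')| = `|K * (b - b') - K * (a - a')|.
  by rewrite -[X in X * _](gtr0_norm K0) -normrM; congr (`|_|); ring.
move=> sep; have : K * e0 <= Num.max `|K * (a - a')| `|K * (b - b')|.
  by rewrite !normrM (gtr0_norm K0) -maxr_pMr ?ler_pM2l// ltW.
move: kM; set x := K * (a - a'); set y := K * (b - b') => kM.
(* [L] is the scaled difference at [t], with [|L| <= C], and [s] is its slope; [|x|] and [|y|] are
   at most [|L| + |s|], so [|s| >= K * e0 - C >= M]. *)
set L := (1 - t) * x + t * y; set s := y - x.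
have xE : x = L - t * s by rewrite /L /s; ring.
have yE : y = L + (1 - t) * s by rewrite /L /s; ring.
have xs : `|x| <= `|L| + `|s|.
  rewrite xE; apply: le_trans (ler_normB _ _) _; rewrite lerD2l normrM.
  by rewrite ger0_norm// ler_piMl.
have ys : `|y| <= `|L| + `|s|.
  rewrite yE; apply: le_trans (ler_normD _ _) _; rewrite lerD2l normrM.
  by rewrite ger0_norm ?subr_ge0// ler_piMl// gerBl.
rewrite le_max => /orP[|]; lra.
Qed.

Definition uniformly_separated e := [set t | forall k (w w' : k.-tuple D), w != w' ->
  e <= N%:R ^+ k * `|word_val (digit_family t) w - word_val (digit_family t) w'|].

(** Each pair of words imposes a closed condition, its difference being affine in [t]. This gives
    the measurability required by [porous_negligible]. *)
Lemma closed_uniformly_separated e : closed (uniformly_separated e).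
Proof.
pose I := {k & (k.-tuple D * k.-tuple D)%type}.
pose F (i : I) t := N%:R ^+ tag i * `|word_val (digit_family t) (tagged i).1 -
  word_val (digit_family t) (tagged i).2|.
have -> : uniformly_separated e =
    \bigcap_(i in [set i : I | (tagged i).1 != (tagged i).2]) (F i @^-1` [set x | e <= x]).
  apply/seteqP; split=> t; first by move=> sep [k [w w']] /= /sep.
  by move=> sep k w w' ww'; exact: (sep (Tagged (fun k => k.-tuple D * k.-tuple D)%type (w, w'))).
apply: closed_bigI => i _; apply: closed_comp; last exact: closed_ge.
have -> : F i = fun t => N%:R ^+ tag i *
    `|(word_val u (tagged i).1 - word_val u (tagged i).2) +
      t * ((word_val g (tagged i).1 - word_val u (tagged i).1) -
           (word_val g (tagged i).2 - word_val u (tagged i).2))|.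
  apply/funext => t; rewrite /F !word_val_family; congr (_ * `|_|); ring.
move=> t _; apply: cvgM; first exact: cvg_cst.
apply: cvg_norm; apply: cvgD; first exact: cvg_cst.
by apply: cvgM; [exact: cvg_id|exact: cvg_cst].
Qed.

(* By [close_words_steep], at arbitrarily small scales a point has, at bounded
   relative distance, a zero of one of the affine functions
   t |-> word_val (digit_family t) w - word_val (digit_family t) w'. *)
Lemma negligible_uniformly_separated e : 0 < e ->
  mu.-negligible (uniformly_separated e `&` `[0, 1]%classic).
Proof.
move=> e_gt0; apply: porous_negligible.
  by apply: measurableI => //; apply: closed_measurable; exact: closed_uniformly_separated.
move=> t [sep]; rewrite /= in_itv/= => /close_words_steep[C C0 steep].
have Ce0 : 0 < C + e by rewrite addr_gt0.
exists (e / (C + e)) => [|h0 h00]; first by rewrite divr_gt0.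
have [k [w [w' [ww' small large]]]] := steep ((C + e) / h0 + 1).
pose L s := N%:R ^+ k * (word_val (digit_family s) w - word_val (digit_family s) w').
set K := N%:R ^+ k in small large L.
have K0 : 0 < K by exact: Nk_gt0.
pose a := K * ((word_val g w - word_val u w) - (word_val g w' - word_val u w')).
have LE s s' : L s = L s' + a * (s - s').
  by rewrite /L /a !word_val_family; ring.
have a_large : (C + e) / h0 + 1 <= `|a| by rewrite normrM (gtr0_norm K0).
have L_small : `|L t| <= C by rewrite normrM (gtr0_norm K0).
have Ceh : 0 < (C + e) / h0 by rewrite divr_gt0.
have a0 : 0 < `|a| by lra.
have a_neq0 : a != 0 by rewrite -normr_gt0.
(* The hole is centred at the zero of [L], at distance at most [C / |a|] from [t]; within [e / |a|]
   of this zero, [|L| < e]. The scale [(C + e) / |a|] accommodates both and is below [h0]. *)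
exists ((C + e) / `|a|), (t - L t / a); split.
- by rewrite divr_gt0.
- rewrite ltr_pdivrMr// mulrC -ltr_pdivrMr//; lra.
- rewrite mulrA divfK ?gt_eqF// => s; rewrite /ball/= => sy.
  have -> : t - s = L t / a + (t - L t / a - s) by ring.
  apply: le_lt_trans (ler_normD _ _) _; rewrite mulrDl ler_ltD//.
  by rewrite normrM normfV ler_pM2r// invr_gt0.
rewrite mulrA divfK ?gt_eqF// -subset0 => s [[seps _]]; rewrite /ball/=.
rewrite ltr_pdivlMr// -normrM.
have -> : (t - L t / a - s) * a = - L s by rewrite (LE s t); field.
rewrite normrN normrM (gtr0_norm K0) ltNge => /negP; apply.
exact: seps.
Qed.

(** At a [t] outside all the sets [uniformly_separated n.+1%:R^-1], [word_nbhd_small] applies; the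
    exceptional [t] thus lie in a countable union of null sets. *)
Lemma negligible_word_nbhd_large :
  mu.-negligible [set t | 0 <= t <= 1 /\ ~ (forall e, 0 < e ->
    exists2 rho, 0 < rho & (mu (word_nbhd N (digit_family t) rho) < e%:E)%E)].
Proof.
have : mu.-negligible (\bigcup_n (uniformly_separated n.+1%:R^-1 `&` `[0, 1]%classic)).
  by apply: negligible_bigcup => n; apply: negligible_uniformly_separated.
apply: negligibleS => t [t01 not_small]; apply: contrapT => notin.
apply/not_small/(word_nbhd_small N_gt1 cardD (family_z t)) => e e_gt0.
apply: contrapT => sep; apply: notin.
exists (Num.truncn e^-1) => //; split; last by rewrite /= in_itv.
move=> k w w' ww'; rewrite leNgt; apply/negP => lt; apply: sep.
exists k, w, w'; split=> //; apply: lt_trans lt _.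
by rewrite invf_plt ?posrE// truncnS_gt.
Qed.

End family.

(** Tonelli: by uniqueness [\x] equals [\x^], which integrates the measures of the sections over the
    second factor. *)
Lemma negligible_product_ysection d1 d2 (T1 : measurableType d1)
    (T2 : measurableType d2) (R : realType)
    (m1 : {sigma_finite_measure set T1 -> \bar R})
    (m2 : {sigma_finite_measure set T2 -> \bar R}) (A : set (T1 * T2)) :
  measurable A -> m2.-negligible [set y | m1 (ysection A y) <> 0%E] ->
  (m1 \x m2)%E.-negligible A.
Proof.
move=> mA nullA; apply/negligibleP => //.
transitivity ((m1 \x^ m2)%E A).
  by apply: product_measure_unique => // B C mB mC; exact: product_measure2E.
rewrite /product_measure2 (@ae_eq_integral _ _ _ _ _ (cst 0%E))//.
- by rewrite integral0.
- exact: measurable_fun_ysection.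
- by apply: negligibleS nullA => y /= H; apply: contra_not H.
Qed.

(** The tails lie in [[0, c]], so they can make up for at most [c] of the gap [2 * c] between the
    first digits. *)
Lemma word_val_first_digit (R : realType) (D : finType) (N : nat)
    (f : D -> R) (c : R) d d' v v' :
  (1 < N)%N -> 0 <= c -> (forall x, 0 <= f x <= c * (N%:R - 1)) ->
  2 * c <= `|f d - f d'| ->
  c / N%:R <= `|word_val N f (d :: v) - word_val N f (d' :: v')|.
Proof.
move=> N_gt1 c0 fc dd'.
have N0 : 0 < N%:R :> R by rewrite ltr0n ltnW.
rewrite /= -mulrBl normrM normfV (gtr0_norm N0) ler_pM2r ?invr_gt0//.
have := word_val_itv N_gt1 v fc c0; have := word_val_itv N_gt1 v' fc c0.
set x := word_val _ _ v; set x' := word_val _ _ v' => /andP[? ?] /andP[? ?].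
have -> : f d + x - (f d' + x') = (f d - f d') - (x' - x) by ring.
have := lerB_normD (f d - f d') (- (x' - x)); rewrite normrN.
have : `|x' - x| <= c by rewrite ler_norml; apply/andP; split; lra.
lra.
Qed.

(** * Nullity of the union, with pairs of digits as alphabet *)

Section product_digits.
Variables (R : realType) (r s : nat).
Hypotheses (r_gt1 : (1 < r)%N) (s_gt1 : (1 < s)%N).
Notation N := (r * s)%N.
Notation D := ('I_r * 'I_s)%type.
Notation mu := (@lebesgue_measure R).

(** One alphabet of [r * s] pairs serves both sets: the first coordinate gives the digits of [E^r],
    the second those of [r E^s]. *)
Definition digit1 (d : D) : R := d.1%:R.
Definition digit2 (d : D) : R := r%:R * d.2%:R.

Let N_gt1 : (1 < N)%N.
Proof. by rewrite -[1%N]muln1; apply: ltn_mul. Qed.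

Let zero : D := (Ordinal (ltnW r_gt1), Ordinal (ltnW s_gt1)).

Let r2 : 2 <= r%:R :> R. Proof. by rewrite ler_nat. Qed.
Let s2 : 2 <= s%:R :> R. Proof. by rewrite ler_nat. Qed.

Let ord_le n (i : 'I_n) : 0 <= (i%:R : R) <= n%:R - 1.
Proof. by rewrite ler0n lerBrDr natr1 ler_nat ltn_ord. Qed.

Let ord_neq n (i j : 'I_n) : i != j -> 1 <= `|i%:R - j%:R : R|.
Proof.
rewrite -val_eqE neq_ltn => /orP[] ij; [rewrite distrC|];
  (rewrite ger0_norm ?subr_ge0 ?ler_nat ?(ltnW ij)//;
   by rewrite lerBrDr addrC natr1 ler_nat).
Qed.

(** [word_val_first_digit] applies with [c] half the least gap between digits: [1 / 2] if the first
    coordinates differ, [r / 2] if the second do. *)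
Lemma product_digits_separated (d d' : D) v v' : d != d' ->
  1 / 2 / N%:R <=
    Num.max `|word_val N digit1 (d :: v) - word_val N digit1 (d' :: v')|
            `|word_val N digit2 (d :: v) - word_val N digit2 (d' :: v')|.
Proof.
have N0 : 0 < N%:R :> R by rewrite ltr0n ltnW.
have NE : N%:R = r%:R * s%:R :> R by rewrite natrM.
have r0 : 0 < r%:R :> R by have := r2; lra.
have s0 : 0 < s%:R :> R by have := s2; lra.
have N2r : r%:R * 2 <= r%:R * s%:R :> R by rewrite ler_pM2l.
have N2s : 2 * s%:R <= r%:R * s%:R :> R by rewrite ler_pM2r.
have [R2 S2] : 2 <= r%:R :> R /\ 2 <= s%:R :> R by [].
case: d d' => [d1 d2] [d1' d2']; rewrite xpair_eqE negb_and le_max => /orP[dd'|dd'].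
  apply/orP; left; apply: word_val_first_digit => //.
    move=> [x1 x2]; rewrite /digit1 /=; have /andP[-> ?] := ord_le x1.
    rewrite NE /=; lra.
  by rewrite /digit1/=; have := ord_neq dd'; lra.
apply/orP; right; apply: (@le_trans _ _ (r%:R / 2 / N%:R)).
  by rewrite ler_pM2r ?invr_gt0//; lra.
apply: word_val_first_digit => //.
  move=> [x1 x2]; rewrite /digit2 /=; have /andP[? ?] := ord_le x2.
  by rewrite mulr_ge0//= NE -mulrA ler_pM2l; lra.
rewrite /digit2/= -mulrBr normrM ger0_norm//.
have := ord_neq dd'; nra.
Qed.

(** The second coordinate is the height; the intersection over [n] is a measurable set containing
    the union of the segments. *)
Definition slab (n : nat) : set (measurableTypeR R * measurableTypeR R) :=
  [set x | 0 <= x.2 <= 1 /\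
     word_nbhd N (digit_family digit1 digit2 x.2) n.+1%:R^-1 x.1].

Lemma measurable_slab n : measurable (slab n).
Proof.
pose f w (x : measurableTypeR R * measurableTypeR R) : measurableTypeR R :=
  `|x.1 - ((1 - x.2) * word_val N digit1 w + x.2 * word_val N digit2 w)|.
have mf w : measurable_fun setT (f w).
  apply: measurableT_comp => //; apply: measurable_funB => //.
  apply: measurable_funD; apply: measurable_funM => //.
  exact: measurable_funB.
have -> : slab n = (snd @^-1` `[0, 1]%classic) `&`
    \bigcup_(w in [set: seq D]) (f w @^-1` `]-oo, n.+1%:R^-1[%classic).
  apply/seteqP; split=> -[x t] /=; rewrite /slab/= in_itv/=.
    move=> [t01 [w xw]]; split=> //; exists w => //; rewrite /= in_itv/=.
    by rewrite /f/= -word_val_family.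
  move=> [t01 [w _]]; rewrite /= in_itv/= /f/= => xw; split=> //; exists w.
  by rewrite word_val_family.
apply: measurableI.
  by rewrite -[X in measurable X]setTI; exact: measurable_snd.
apply: countable_bigcupT_measurable => [|w]; first exact: countableP.
by rewrite -[X in measurable X]setTI; exact: mf.
Qed.

(** Sections at heights outside [[0, 1]] are empty; the others lie in every neighbourhood of radius
    [1 / (n + 1)], so they are null off the exceptional heights of [negligible_word_nbhd_large]. *)
Lemma negligible_slabs : (mu \x mu)%E.-negligible (\bigcap_n slab n).
Proof.
have mslabs : measurable (\bigcap_n slab n).
  by apply: bigcapT_measurable; exact: measurable_slab.
apply: negligible_product_ysection => //.
have e0 : 0 < 1 / 2 / N%:R :> R by rewrite divr_gt0// ltr0n ltnW.
have cardD : #|{: D}| = N by rewrite card_prod !card_ord.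
have zero1 : digit1 zero = 0 by [].
have zero2 : digit2 zero = 0 by rewrite /digit2 mulr0.
apply: negligibleS (negligible_word_nbhd_large N_gt1 cardD zero1 zero2 e0
  product_digits_separated).
move=> t /= not0; have [t01|t01] := boolP (0 <= t <= 1); last first.
  exfalso; apply: not0; rewrite (_ : ysection _ _ = set0) ?measure0//.
  rewrite -subset0 => x; rewrite /ysection/= inE => /(_ 0%N I)[/= t01' _].
  by rewrite t01' in t01.
split=> // small; apply: not0; apply/eqP; rewrite eq_le measure_ge0 andbT.
apply/lee_addgt0Pr => e e_gt0; rewrite add0e.
have [rho rho0 /ltW] := small e e_gt0; apply: le_trans.
rewrite le_measure// ?inE; [exact: measurable_ysection|exact: measurable_word_nbhd|].
move=> x; rewrite /ysection/= inE => /(_ (Num.truncn rho^-1) I)[/= _].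
apply: word_nbhdS; rewrite invf_ple ?posrE//.
exact: ltW (truncnS_gt _).
Qed.

(** At height [t] the abscissa is [(1 - t) * e + t * (r * f)], the limit of the values of the words
    formed by the first digit pairs of [e] and [f]. *)
Lemma segments_between_slabs :
  segments_between (@real_pt R @` digit_set R N r)
    [set r%:R *: z + imag_unit R | z in @real_pt R @` digit_set R N s]
  `<=` \bigcap_n slab n.
Proof.
move=> _ [_ [e [eta eta_e] <-]] [_ [_ [f [eta' eta'_f] <-] <-]] [t t01 <-] n _.
have -> : (1 - t) *: real_pt e + t *: (r%:R *: real_pt f + imag_unit R) =
    ((1 - t) * e + t * (r%:R * f), t).
  by apply/pair_equal_spec; split; rewrite /GRing.scale/= /GRing.scale/=; ring.
split; first by move: t01; rewrite /= in_itv.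
have cvg : (1 - t) * (\sum_(1 <= j < k.+1) (eta j)%:R * N%:R ^- j) +
    t * (r%:R * (\sum_(1 <= j < k.+1) (eta' j)%:R * N%:R ^- j)) @[k --> \oo]
    --> (1 - t) * e + t * (r%:R * f).
  apply: cvgD; first by apply: cvgMr.
  by apply: cvgMr; apply: cvgMr.
have n0 : 0 < n.+1%:R^-1 :> R by rewrite invr_gt0.
move/cvgrPdist_lt: cvg => /(_ _ n0)[k _ /(_ k (leqnn k))] /= close.
exists [seq (eta j, eta' j) | j <- iota 1 k].
rewrite word_val_map_iota// (le_lt_trans _ close)// le_eqVlt; apply/orP; left.
apply/eqP; congr (`|_ - _|); rewrite !mulr_sumr -big_split/=.
by apply: eq_bigr => j _; rewrite /digit_family /digit1 /digit2/=; ring.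
Qed.

Lemma plane_null_segments_between :
  plane_null (segments_between (@real_pt R @` digit_set R N r)
    [set r%:R *: z + imag_unit R | z in @real_pt R @` digit_set R N s]).
Proof.
apply: (@negligibleS _ _ _ (mu \x mu)%E (\bigcap_n slab n)); last exact: negligible_slabs.
exact: segments_between_slabs.
Qed.

End product_digits.

(** * Digit expansions: symmetry of E^r and the sum E^r + r E^s *)

Section digit_sets.
Variable R : realType.

Lemma sum_geometric (b n : nat) : (1 < b)%N ->
  \sum_(1 <= j < n.+1) b%:R ^- j = (1 - b%:R ^- n) / (b%:R - 1) :> R.
Proof.
move=> b1; have b0 : b%:R != 0 :> R by rewrite pnatr_eq0 -lt0n ltnW.
have b10 : b%:R - 1 != 0 :> R by rewrite subr_eq0 (eqr_nat _ b 1) gtn_eqF.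
elim: n => [|n IHn]; first by rewrite big_geq// expr0 invr1 subrr mul0r.
rewrite big_nat_recr// IHn exprS /=; field.
by rewrite b10 b0 expf_neq0.
Qed.

Lemma cvg_invX (b : nat) : (1 < b)%N -> (b%:R ^- n : R) @[n --> \oo] --> (0 : R).
Proof.
move=> b1; rewrite (_ : (fun n => _) = (fun n => (b%:R^-1 : R) ^+ n)).
  apply: cvg_expr; rewrite normfV ger0_norm// invf_lt1 ?ltr1n//.
  by rewrite ltr0n ltnW.
by apply/funext => n; rewrite exprVn.
Qed.

Lemma is_cvg_digit_sum (b d : nat) (eta : nat -> 'I_d) : (1 < b)%N -> (d <= b)%N ->
  cvgn (fun n => \sum_(1 <= j < n.+1) (eta j)%:R * b%:R ^- j : R).
Proof.
move=> b1 db; have b0 : 0 < b%:R :> R by rewrite ltr0n ltnW.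
apply: nondecreasing_is_cvgn.
  apply/nondecreasing_seqP => n; rewrite [leRHS]big_nat_recr//= lerDl.
  by rewrite mulr_ge0// invr_ge0 exprn_ge0.
exists 1 => _ [n _ <-]; apply: (@le_trans _ _ (1 - b%:R ^- n)); last first.
  by rewrite gerBl invr_ge0 exprn_ge0.
elim: n => [|n IHn]; first by rewrite big_geq// expr0 invr1 subrr.
rewrite big_nat_recr//=; apply: le_trans (lerD IHn (lexx _)) _.
have : (eta n.+1)%:R <= b%:R - 1 :> R.
  by rewrite lerBrDr natr1 ler_nat (leq_trans (ltn_ord _)).
have bn0 : 0 < b%:R ^+ n.+1 :> R by rewrite exprn_gt0.
rewrite -(ler_pM2r (_ : 0 < b%:R ^- n.+1)) ?invr_gt0//.
rewrite (_ : (b%:R - 1) * _ = b%:R ^- n - b%:R ^- n.+1); first lra.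
by rewrite exprS; field; rewrite !gt_eqF// exprn_gt0.
Qed.

(** Complementing every digit, [eta |-> d - 1 - eta], subtracts the sum from the largest one,
    [(d - 1) / (b - 1)]. *)
Lemma digit_set_sym (b d : nat) (e : R) : (1 < b)%N ->
  digit_set R b d e -> digit_set R b d ((d%:R - 1) / (b%:R - 1) - e).
Proof.
move=> b1 [eta eta_e]; exists (fun j => rev_ord (eta j)).
rewrite (_ : (fun n => _) = (fun n => (d%:R - 1) * ((1 - b%:R ^- n) / (b%:R - 1)) -
    \sum_(1 <= j < n.+1) (eta j)%:R * b%:R ^- j)); last first.
  apply/funext => n; rewrite -sum_geometric// mulr_sumr -sumrB.
  apply: eq_bigr => j _; rewrite -mulrBl natrB ?ltn_ord// -natr1.
  by congr (_ * _); ring.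
apply: cvgB => //; rewrite -[X in X @ _ --> _]/(fun n => _).
rewrite -[X in _ --> X](_ : (d%:R - 1) * ((1 - 0) / (b%:R - 1)) = _); last first.
  by rewrite subr0 mul1r.
apply: cvgMr; apply: cvgMl; apply: cvgB; first exact: cvg_cst.
exact: cvg_invX.
Qed.

(** With [m n] the integer part of [y * b ^ n], the digits [m j %% b] have partial sums
    [m n / b ^ n], because [m n = m n.+1 %/ b] and [m 0 = 0]. *)
Lemma base_expansion (b : nat) (y : R) : (1 < b)%N -> 0 <= y < 1 ->
  digit_set R b b y.
Proof.
move=> b1 /andP[y0 y1]; have b_gt0 := ltnW b1.
have b0 : 0 < b%:R :> R by rewrite ltr0n.
pose m n := Num.truncn (y * b%:R ^+ n).
have ybn0 n : 0 <= y * b%:R ^+ n by rewrite mulr_ge0// exprn_ge0.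
have mP n := truncn_itv (ybn0 n).
have mS n : m n = (m n.+1 %/ b)%N.
  apply: truncn_def; rewrite -/(m _).
  have /andP[lo hi] := mP n.+1; apply/andP; split.
    rewrite -(ler_pM2r b0) -mulrA -exprSr; apply: le_trans lo.
    by rewrite -natrM ler_nat leq_divM.
  rewrite -(ltr_pM2r b0) -mulrA -exprSr; apply: lt_le_trans hi _.
  by rewrite -natrM ler_nat ltn_ceil.
exists (fun j => Ordinal (ltn_pmod (m j) b_gt0)).
have sumE n : \sum_(1 <= j < n.+1) (m j %% b)%:R * b%:R ^- j = (m n)%:R / b%:R ^+ n :> R.
  elim: n => [|n IHn].
    rewrite big_geq// expr0 divr1 /m expr0 mulr1.
    by rewrite (@truncn_def _ _ 0)// y0 y1.
  rewrite big_nat_recr//= IHn [in RHS](divn_eq (m n.+1) b) -mS natrD natrM exprS.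
  by field; rewrite !gt_eqF// exprn_gt0.
apply: (@squeeze_cvgr _ _ _ _ (fun n => y - b%:R ^- n) (cst y)); last 2 first.
- rewrite -[X in _ --> X]subr0; apply: cvgB; [exact: cvg_cst|exact: cvg_invX].
- exact: cvg_cst.
apply: nearW => n; rewrite [X in _ <= X <= _](sumE n).
have /andP[lo hi] := mP n; have bn0 : 0 < b%:R ^+ n :> R by rewrite exprn_gt0.
rewrite ler_pdivrMr// lo andbT lerBlDr -{2}[b%:R ^- n]mul1r -mulrDl natr1.
by rewrite ler_pdivlMr// ltW.
Qed.

(** Each digit in base [r * s] splits as [zeta %% r + r * (zeta %/ r)], with remainder below [r] and
    quotient below [s]. *)
Lemma digit_set_sum (r s : nat) (y : R) : (1 < r)%N -> (1 < s)%N -> 0 <= y < 1 ->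
  exists e f, [/\ digit_set R (r * s) r e, digit_set R (r * s) s f & y = e + r%:R * f].
Proof.
move=> r1 s1 y01; have rs1 : (1 < r * s)%N by rewrite -[1%N]muln1; apply: ltn_mul.
have [zeta zeta_y] := base_expansion rs1 y01.
have zr j : (zeta j %% r < r)%N by rewrite ltn_pmod// ltnW.
have zs j : (zeta j %/ r < s)%N by rewrite ltn_divLR ?(ltnW r1)// [(s * r)%N]mulnC; exact: ltn_ord.
pose sum_r n : R := \sum_(1 <= j < n.+1) (Ordinal (zr j))%:R * (r * s)%:R ^- j.
pose sum_s n : R := \sum_(1 <= j < n.+1) (Ordinal (zs j))%:R * (r * s)%:R ^- j.
have cvg_r : sum_r @ \oo --> limn sum_r.
  exact: (@is_cvg_digit_sum _ _ (fun j => Ordinal (zr j)) rs1 (leq_pmulr _ (ltnW s1))).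
have cvg_s : sum_s @ \oo --> limn sum_s.
  exact: (@is_cvg_digit_sum _ _ (fun j => Ordinal (zs j)) rs1 (leq_pmull _ (ltnW r1))).
exists (limn sum_r), (limn sum_s); split.
- by exists (fun j => Ordinal (zr j)).
- by exists (fun j => Ordinal (zs j)).
apply: (cvg_unique _ zeta_y) => //.
rewrite (_ : (fun n => _) = (fun n => sum_r n + r%:R * sum_s n)); last first.
  apply/funext => n; rewrite mulr_sumr -big_split/=; apply: eq_bigr => j _.
  by rewrite {1}(divn_eq (zeta j) r) natrD natrM; ring.
by apply: cvgD => //; apply: cvgMr.
Qed.

End digit_sets.

(** * The open set of directions *)

Lemma open_slope_cone (R : realType) (a b : R) :
  open [set u : R * R | [/\ 0 < u.2, a * u.2 < u.1 & u.1 < b * u.2]].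
Proof.
have openP (phi : R * R -> R) : continuous phi -> open [set u | 0 < phi u].
  move=> cphi; apply: (@open_comp _ _ phi [set x | 0 < x]); last exact: open_gt.
  by move=> u _; exact: cphi.
have cfst : continuous (fun u : R * R => u.1) by move=> u; exact: cvg_fst.
have csnd : continuous (fun u : R * R => u.2) by move=> u; exact: cvg_snd.
have -> : [set u : R * R | [/\ 0 < u.2, a * u.2 < u.1 & u.1 < b * u.2]] =
    [set u | 0 < u.2] `&` [set u | 0 < u.1 - a * u.2] `&` [set u | 0 < b * u.2 - u.1].
  apply/seteqP; split=> u /=; first by move=> [? ? ?]; rewrite !subr_gt0.
  by rewrite !subr_gt0 => -[[]].
apply: openI; first apply: openI; apply: openP => // u.
  apply: cvgB; [exact: cfst|apply: cvgMr; exact: csnd].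
apply: cvgB; [apply: cvgMr; exact: csnd|exact: cfst].
Qed.

(** Write [x + c = e + r * f] and exchange [e] for [c - e], by the symmetry of [E^r]. *)
Lemma digit_set_sub (R : realType) (r s : nat) (x : R) : (1 < r)%N -> (1 < s)%N ->
  let c := (r%:R - 1) / ((r * s)%:R - 1) in - c <= x < 1 - c ->
  exists e f, [/\ digit_set R (r * s) r e, digit_set R (r * s) s f & r%:R * f = e + x].
Proof.
move=> r1 s1 c /andP[cx xc].
have rs1 : (1 < r * s)%N by rewrite -[1%N]muln1; apply: ltn_mul.
have y01 : 0 <= x + c < 1 by apply/andP; split; lra.
have [e [f [He Hf xE]]] := digit_set_sum r1 s1 y01.
exists (c - e), f; split=> //; first exact: digit_set_sym.
have -> : x = e + r%:R * f - c by rewrite -xE addrK.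
ring.
Qed.

Theorem mainTheorem4 (R : realType) (r s : nat)
    (r_prime : prime r) (s_prime : prime s) (r_neq_s : r <> s) :
  let Er := @real_pt R @` digit_set R (r * s)%N r in
  let Es := @real_pt R @` digit_set R (r * s)%N s in
  let rEs_i := [set r%:R *: z + imag_unit R | z in Es] in
  wide_besicovitch (segments_between Er rEs_i).
Proof.
have [r1 s1] := (prime_gt1 r_prime, prime_gt1 s_prime).
split; first exact: plane_null_segments_between.
pose c : R := (r%:R - 1) / ((r * s)%:R - 1).
have rR : 1 < r%:R :> R by rewrite ltr1n.
have rsR : r%:R < (r * s)%:R :> R by rewrite ltr_nat ltn_Pmulr// ltnW.
have c0 : 0 < c by rewrite divr_gt0 ?subr_gt0//; lra.
have c1 : c < 1 by rewrite ltr_pdivrMr ?mul1r; lra.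
(* A segment from height 0 to height 1 has direction proportional to [(r * f - e, 1)]; the cone asks
   that the displacement per unit height, [u.1 / u.2], lie in []-c, 1 - c[]. *)
exists [set u : R * R | [/\ 0 < u.2, - c * u.2 < u.1 & u.1 < (1 - c) * u.2]]; split.
- exact: open_slope_cone.
- exists (0, 1); rewrite /unit_circle/=; split; first by split=> /=; lra.
  by rewrite expr0n expr1n add0r.
move=> [a b] [[/= b0 ca ac] _].
have x_itv : - c <= a / b < 1 - c by rewrite ler_pdivlMr// ltr_pdivrMr// ltW.
have [e [f [He Hf feE]]] := digit_set_sub r1 s1 x_itv.
(* The factor [b^-1] makes the segment end exactly at height 1, at abscissa [e + a / b = r * f]. *)
exists (real_pt e), b^-1; split; first by rewrite invr_gt0.
have -> : real_pt e + b^-1 *: (a, b) = r%:R *: real_pt f + imag_unit R.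
  apply/pair_equal_spec; split; rewrite /= /GRing.scale/=.
    by rewrite addr0 feE mulrC.
  by rewrite mulVf ?gt_eqF// mulr0.
move=> x px; exists (real_pt e); first by exists e.
exists (r%:R *: real_pt f + imag_unit R) => //.
by exists (real_pt f) => //; exists f.
Qed.
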